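(* Let $\alpha$ be an ordinal. Then every $\alpha$-Jacobson ring is Jacobson.
   Context: All rings are commutative with identity (the trivial ring is allowed). For a subset $U$ of a ring $A$, $\langle U\rangle$ denotes the ideal generated by $U$, and $\mathrm{Nil}_A U:=\{x\in A:\exists n\ge 0,\ x^n\in\langle U\rangle\}$, $\mathrm{Jac}_A U:=\{x\in A:\forall a\in A,\ 1\in\langle U\cup\{1-ax\}\rangle\}$. A ring $A$ is called Jacobson if $\mathrm{Jac}_A U\subseteq\mathrm{Nil}_A U$ for every subset $U\subseteq A$. $\mathrm{Nil}_A 0$ denotes the nilradical of $A$. The image of an element in a quotient ring is denoted by the same letter. For a ring $A$, elements $x,x'\in A$ and an ordinal $\alpha$, the property ''the triple $(A,x,x')$ is $\alpha$-Jacobson'' is defined by recursion on $\alpha$: (1) $(A,x,x')$ is $0$-Jacobson if $x'\in\mathrm{Nil}_A 0$. (2) For $\alpha>0$, $(A,x,x')$ is $\alpha$-Jacobson if there exist $n\ge 0$ and $a_1,\ldots,a_n\in A$ such that for any $b_1,\ldots,b_n\in A$ there exists an ordinal $\beta<\alpha$ such that $(A/\langle 1-b_i(1-a_ix): i\in\{1,\ldots,n\}\rangle,\,x,\,x')$ is $\beta$-Jacobson. A ring $A$ is called $\alpha$-Jacobson if $(A,x,x)$ is $\alpha$-Jacobson for all $x\in A$. *)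

(* Defs.v *)
From HB Require Import structures.
From mathcomp Require Import all_boot all_order all_algebra.
From mathcomp Require Import boolp classical_sets.

Set Implicit Arguments.
Unset Strict Implicit.
Unset Printing Implicit Defensive.

Import Order.TTheory GRing.Theory.

Local Open Scope classical_set_scope.
Local Open Scope ring_scope.
Local Open Scope quotient_scope.

(* Rings are [comPzRingType]s, so that the trivial ring is included; the
   library's [idealr] excludes the unit ideal and is therefore not usable. *)
Definition is_ideal (A : comPzRingType) (I : set A) : Prop :=
  [/\ I 0, forall x y, I x -> I y -> I (x + y)
    & forall a x, I x -> I (a * x)].

Definition ideal_gen (A : comPzRingType) (U : set A) : set A :=
  smallest (@is_ideal A) U.

Lemma ideal_gen_ideal (A : comPzRingType) (U : set A) :
  is_ideal (ideal_gen U).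
Proof.
split=> [J [[J0 _ _] _] //|x y Ix Iy J JU|a x Ix J JU].
- by case: (JU) => -[_ JD _] _; apply: JD; [apply: Ix|apply: Iy].
- by case: (JU) => -[_ _ JM] _; apply: JM; apply: Ix.
Qed.

Definition Nil (A : comPzRingType) (U : set A) : set A :=
  [set x | exists n : nat, ideal_gen U (x ^+ n)].

Definition Jac (A : comPzRingType) (U : set A) : set A :=
  [set x | forall a : A, ideal_gen (U `|` [set 1 - a * x]) 1].

Definition Jacobson (A : comPzRingType) : Prop :=
  forall U : set A, Jac U `<=` Nil U.

(* The quotient ring A / <U>. The additive group is the library's [{quot _}];
   the library provides the multiplication only for proper ideals of nonzero
   rings, so it is redone here. *)
Section QuotientRing.
Variables (A : comPzRingType) (U : set A).

Definition ideal_pred : {pred A} := fun x => `[< ideal_gen U x >].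

Lemma ideal_predE x : (x \in ideal_pred) = `[< ideal_gen U x >].
Proof. by []. Qed.

Lemma ideal_pred_zmod_closed : zmod_closed ideal_pred.
Proof.
have [I0 ID IM] := ideal_gen_ideal U.
split=> [|x y]; rewrite !ideal_predE; first exact/asboolP.
move=> /asboolP Ix /asboolP Iy; apply/asboolP; apply: (ID _ _ Ix).
by rewrite -mulN1r; apply: IM.
Qed.

HB.instance Definition _ :=
  GRing.isZmodClosed.Build A ideal_pred ideal_pred_zmod_closed.

Lemma ideal_predM (a x : A) : x \in ideal_pred -> a * x \in ideal_pred.
Proof.
have [_ _ IM] := ideal_gen_ideal U.
rewrite !ideal_predE => /asboolP Ix; apply/asboolP.
exact: IM.
Qed.

Definition quot_ring : Type := Quotient.quot ideal_pred.

HB.instance Definition _ :=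
  ZmodQuotient.copy quot_ring (Quotient.quot ideal_pred).

Definition quot_one : quot_ring := lift_cst quot_ring 1.
Definition quot_mul := lift_op2 quot_ring *%R.

Canonical pi_quot_one_morph := PiConst quot_one.

Lemma pi_quotP (x y : A) :
  (x == y %[mod quot_ring]) = (x - y \in ideal_pred).
Proof. by rewrite -Quotient.idealrBE. Qed.

Lemma pi_quot_mul : {morph \pi_quot_ring : x y / x * y >-> quot_mul x y}.
Proof.
move=> x y; unlock quot_mul; apply/eqP; rewrite pi_quotP.
set x' := repr _; set y' := repr _.
have -> : x * y - x' * y' = x * (y - y') + y' * (x - x').
  by rewrite !mulrBr addrA [y' * x]mulrC subrK [y' * x']mulrC.
by rewrite rpredD // ideal_predM // -pi_quotP reprK.
Qed.
Canonical pi_quot_mul_morph := PiMorph2 pi_quot_mul.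

Lemma quot_mulA : associative quot_mul.
Proof. by move=> x y z; rewrite -[x]reprK -[y]reprK -[z]reprK !piE mulrA. Qed.

Lemma quot_mulC : commutative quot_mul.
Proof. by move=> x y; rewrite -[x]reprK -[y]reprK !piE mulrC. Qed.

Lemma quot_mul1 : left_id quot_one quot_mul.
Proof. by move=> x; rewrite -[x]reprK !piE mul1r. Qed.

Lemma quot_mulDl : left_distributive quot_mul +%R.
Proof.
by move=> x y z; rewrite -[x]reprK -[y]reprK -[z]reprK !piE mulrDl.
Qed.

HB.instance Definition _ :=
  GRing.Zmodule_isComPzRing.Build quot_ring
    quot_mulA quot_mulC quot_mul1 quot_mulDl.

Definition quot_map (x : A) : quot_ring := \pi_quot_ring x.

Lemma quot_map_zmod_morphism : zmod_morphism quot_map.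
Proof. by move=> x y; rewrite /quot_map !piE. Qed.
HB.instance Definition _ :=
  GRing.isZmodMorphism.Build A quot_ring quot_map quot_map_zmod_morphism.

Lemma quot_map_monoid_morphism : monoid_morphism quot_map.
Proof. by split=> [|x y]; rewrite /quot_map !piE. Qed.
HB.instance Definition _ :=
  GRing.isMonoidMorphism.Build A quot_ring quot_map quot_map_monoid_morphism.

Lemma quot_map_surj (y : quot_ring) : exists x, quot_map x = y.
Proof. by exists (repr y); rewrite /quot_map reprK. Qed.

Lemma quot_map_eq0 (x : A) : quot_map x = 0 <-> ideal_gen U x.
Proof.
rewrite -[0](rmorph0 quot_map) (rwP eqP) pi_quotP subr0 ideal_predE.
by split=> /asboolP.
Qed.

End QuotientRing.

(* An ordinal is given as an element [alpha] of an arbitrary well-ordered type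
   [O]: the ordinals below [alpha] are the elements below it in [O], and 0 is
   the least element of [O]. Every ordinal arises so, e.g. as the top element
   of its successor. *)
Section AlphaJacobson.
Context (d : Order.disp_t) (O : orderType d).
Context (wfO : well_founded (fun beta alpha : O => (beta < alpha)%O)).

Definition ord_zero (alpha : O) : Prop := forall beta : O, (alpha <= beta)%O.

Definition jacobson_step (alpha : O)
    (rec : forall beta : O, (beta < alpha)%O ->
             forall A : comPzRingType, A -> A -> Prop)
    (A : comPzRingType) (x x' : A) : Prop :=
  (ord_zero alpha /\ Nil [set 0] x') \/
  (~ ord_zero alpha /\
   exists (n : nat) (a : 'I_n -> A), forall b : 'I_n -> A,
     let U := range (fun i : 'I_n => 1 - b i * (1 - a i * x)) in
     exists (beta : O) (lt_beta : (beta < alpha)%O),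
       rec beta lt_beta (quot_ring U) (quot_map U x) (quot_map U x')).

Definition jacobson_triple :
    O -> forall A : comPzRingType, A -> A -> Prop :=
  Fix wfO (fun _ => forall A : comPzRingType, A -> A -> Prop) jacobson_step.

Lemma jacobson_tripleE (alpha : O) (A : comPzRingType) (x x' : A) :
  jacobson_triple alpha x x' =
  jacobson_step (fun beta (_ : (beta < alpha)%O) => jacobson_triple beta) x x'.
Proof.
rewrite /jacobson_triple Fix_eq // => {A x x'}alpha f g fg.
suff -> : f = g by [].
by apply: functional_extensionality_dep => beta;
  apply: functional_extensionality_dep => lt_beta; apply: fg.
Qed.

Lemma jacobson_triple0 (alpha : O) (A : comPzRingType) (x x' : A) :
  ord_zero alpha -> jacobson_triple alpha x x' <-> Nil [set 0] x'.
Proof.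
by move=> alpha0; rewrite jacobson_tripleE; split=> [[[]|[]]|] //; left.
Qed.

Lemma jacobson_triple_gt0 (alpha : O) (A : comPzRingType) (x x' : A) :
  ~ ord_zero alpha ->
  jacobson_triple alpha x x' <->
  exists (n : nat) (a : 'I_n -> A), forall b : 'I_n -> A,
    let U := range (fun i : 'I_n => 1 - b i * (1 - a i * x)) in
    exists2 beta : O, (beta < alpha)%O &
      jacobson_triple beta (quot_map U x) (quot_map U x').
Proof.
move=> alpha0; rewrite jacobson_tripleE; split=> [[[]|[_]]|] // [n [a H]].
  by exists n, a => b; have [beta [lt_beta Hbeta]] := H b; exists beta.
right; split=> //; exists n, a => b.
by have [beta lt_beta Hbeta] := H b; exists beta, lt_beta.
Qed.

Definition alpha_Jacobson (alpha : O) (A : comPzRingType) : Prop :=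
  forall x : A, jacobson_triple alpha x x.

End AlphaJacobson.

(* Main.v *)
Require Import Defs.
From mathcomp Require Import all_boot all_order all_algebra.
From mathcomp Require Import boolp classical_sets.

(* By induction on [alpha], if [(A, x, x')] is [alpha]-Jacobson then
   [x \in Jac U] implies [x' \in Nil U] for every [U]. If [x \in Jac U], one may
   choose the [b_i] with [1 - b_i (1 - a_i x) \in <U>]; the quotient by these
   elements is then intermediate between [A] and [A / <U>], so that membership
   in [Nil U] may be tested there. *)

Set Implicit Arguments.
Unset Strict Implicit.
Unset Printing Implicit Defensive.

Import GRing.Theory.

Local Open Scope classical_set_scope.
Local Open Scope ring_scope.

Section GeneratedIdeal.
Variable A : comPzRingType.
Implicit Types (U V I : set A) (x y : A).

Lemma sub_ideal_gen U : U `<=` ideal_gen U.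
Proof. exact: sub_smallest. Qed.

Lemma ideal_gen_min U I : is_ideal I -> U `<=` I -> ideal_gen U `<=` I.
Proof. exact: smallest_sub. Qed.

(** The elements congruent modulo [ideal_gen U] to a multiple of [y] form an ideal containing [U]
    and [y]. *)
Lemma ideal_gen_setU1 U y z :
  ideal_gen (U `|` [set y]) z -> exists b : A, ideal_gen U (z - b * y).
Proof.
have [I0 ID IM] := ideal_gen_ideal U.
suff: ideal_gen (U `|` [set y]) `<=` [set z | exists b, ideal_gen U (z - b * y)].
  exact.
apply: ideal_gen_min => [|u [Uu|->]].
- split=> [|u v [b Ib] [c Ic]|a u [b Ib]].
  + by exists 0; rewrite mul0r subr0.
  + by exists (b + c); rewrite mulrDl opprD addrACA; apply: ID.
  + by exists (a * b); rewrite -mulrA -mulrBr; apply: IM.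
- by exists 0; rewrite mul0r subr0; apply: sub_ideal_gen.
- by exists 1; rewrite mul1r subrr.
Qed.

Lemma sub_Nil U V : U `<=` ideal_gen V -> Defs.Nil U `<=` Defs.Nil V.
Proof.
move=> UV x [n Ix]; exists n.
exact: ideal_gen_min (ideal_gen_ideal V) UV _ Ix.
Qed.

End GeneratedIdeal.

Section IdealMorphism.
Variables (A B : comPzRingType) (f : {rmorphism A -> B}).

Lemma ideal_gen_image (U : set A) (x : A) :
  ideal_gen U x -> ideal_gen (f @` U) (f x).
Proof.
have [I0 ID IM] := ideal_gen_ideal (f @` U).
move=> Ix; apply: (ideal_gen_min (I := f @^-1` ideal_gen (f @` U))) Ix.
  split=> [|u v Iu Iv|a u Iu]; rewrite /preimage /= ?rmorph0 ?rmorphD ?rmorphM //.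
    exact: ID.
  exact: IM.
by move=> u Uu; apply: sub_ideal_gen; exists u.
Qed.

Hypothesis f_surj : forall y, exists x, f x = y.

(** Surjectivity makes the image of [ideal_gen U] stable under multiplication by all of [B], hence
    an ideal. *)
Lemma ideal_gen_image_surj (U : set A) :
  ideal_gen (f @` U) `<=` f @` ideal_gen U.
Proof.
have [I0 ID IM] := ideal_gen_ideal U.
apply: ideal_gen_min => [|_ [u Uu <-]]; last first.
  by exists u => //; apply: sub_ideal_gen.
split=> [|_ _ [u Iu <-] [v Iv <-]|a _ [u Iu <-]].
- by exists 0; rewrite ?rmorph0.
- by exists (u + v); rewrite ?rmorphD //; apply: ID.
- by have [c <-] := f_surj a; exists (c * u); rewrite ?rmorphM //; apply: IM.
Qed.

Lemma Jac_image (U : set A) (x : A) : Jac U x -> Jac (f @` U) (f x).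
Proof.
move=> Jx a; have [c <-] := f_surj a.
have := ideal_gen_image (Jx c).
by rewrite image_setU image_set1 rmorphB rmorphM !rmorph1.
Qed.

End IdealMorphism.

Lemma Nil_quot (A : comPzRingType) (U V : set A) (x : A) :
  V `<=` ideal_gen U -> Defs.Nil (quot_map V @` U) (quot_map V x) -> Defs.Nil U x.
Proof.
have [_ ID _] := ideal_gen_ideal U.
move=> VU [n]; rewrite -rmorphXn.
move=> /(ideal_gen_image_surj (@quot_map_surj _ V)) [z Iz /esym zx].
(* The lift [z] of the power lies in [ideal_gen U], and [x ^+ n - z] lies in the kernel
   [ideal_gen V], which [VU] places inside [ideal_gen U]. *)
exists n; rewrite -(subrK z (x ^+ n)); apply: ID => //.
apply: (ideal_gen_min (ideal_gen_ideal U) VU); apply/quot_map_eq0.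
by rewrite rmorphB zx subrr.
Qed.

Lemma jacobson_triple_Nil (d : Order.disp_t) (O : orderType d)
    (wfO : well_founded (fun beta alpha : O => (beta < alpha)%O))
    (alpha : O) (A : comPzRingType) (x x' : A) (U : set A) :
  jacobson_triple wfO alpha x x' -> Jac U x -> Defs.Nil U x'.
Proof.
(* The ring and [U] vary in the induction: the hypothesis is applied to a quotient of [A] and the
   image of [U]. *)
elim/(well_founded_ind wfO): alpha A x x' U => alpha IH A x x' U.
rewrite jacobson_tripleE => -[[_ Nx'] _|[_ [n [a Ha]]] Jx].
  by apply: sub_Nil Nx' => _ ->; have [] := ideal_gen_ideal U.
(* Each [b i] is the coefficient of [1 - a i * x] in an expression of 1 modulo [ideal_gen U]. *)
have /choice [b Ib] i := ideal_gen_setU1 (Jx (a i)).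
have [beta [lt_beta Hbeta]] := Ha b.
apply: (Nil_quot (V := range (fun i => 1 - b i * (1 - a i * x)))).
  by move=> _ [i _ <-]; apply: Ib.
exact: IH lt_beta _ _ _ _ Hbeta (Jac_image (@quot_map_surj _ _) Jx).
Qed.

Theorem corollary5 (d : Order.disp_t) (O : orderType d)
    (wfO : well_founded (fun beta alpha : O => (beta < alpha)%O))
    (alpha : O) (A : comPzRingType) :
  alpha_Jacobson wfO alpha A -> Jacobson A.
Proof. by move=> HA U x; apply: jacobson_triple_Nil (HA x). Qed.
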